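(* Let $K$ be any field. Let $G$ be any Lie nilpotent associative $K$-algebra and let $H$ be a finitely generated Lie nilpotent associative $K$-algebra. Then $G\otimes H$ is again Lie nilpotent.
   Context: All algebras are unital associative $K$-algebras and $\otimes=\otimes_K$. Long commutators are left-normed: $[u_1,u_2]=u_1u_2-u_2u_1$ and $[u_1,\dots,u_{m+1}]=[[u_1,\dots,u_m],u_{m+1}]$ for $m\ge 2$. An algebra $A$ is Lie nilpotent if there is an integer $p\geq 1$ with $[a_1,\dots,a_{p+1}]=0$ for all $a_1,\dots,a_{p+1}\in A$. *)

(* Defs.v *)
From HB Require Import structures.
From mathcomp Require Import all_boot all_algebra generic_quotient.
From mathcomp Require Import boolp.

Set Implicit Arguments.
Unset Strict Implicit.
Unset Printing Implicit Defensive.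

Import GRing.Theory.
Local Open Scope ring_scope.
Local Open Scope quotient_scope.

(* [algType K] demands [1 != 0]. Here the zero algebra is allowed as well, so  *)
(* the axioms of a K-algebra are put on top of [pzRingType]; the K-module      *)
(* structure is then recovered through the instance below.                     *)
HB.mixin Record PzRing_isAssocAlgebra (K : fieldType) A of GRing.PzRing A := {
  algscale : K -> A -> A;
  algscaleA : forall a b v, algscale a (algscale b v) = algscale (a * b) v;
  algscale1 : left_id 1 algscale;
  algscaleDr : right_distributive algscale +%R;
  algscaleDl : forall v, {morph algscale^~ v : a b / a + b};
  algscaleAl : forall k x y, algscale k (x * y) = algscale k x * y;
  algscaleAr : forall k x y, algscale k (x * y) = x * algscale k y
}.

#[short(type="assocAlgType")]
HB.structure Definition AssocAlgebra (K : fieldType) :=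
  {A of GRing.PzRing A & PzRing_isAssocAlgebra K A}.

#[non_forgetful_inheritance]
HB.instance Definition _ (K : fieldType) (A : assocAlgType K) :=
  GRing.Zmodule_isLmodule.Build K (AssocAlgebra.sort A)
    algscaleA algscale1 algscaleDr algscaleDl.

Coercion assocAlg_lmodType (K : fieldType) (A : assocAlgType K) : lmodType K :=
  AssocAlgebra.sort A.

Lemma assoc_scalerAl (K : fieldType) (A : assocAlgType K) (k : K) (x y : A) :
  k *: (x * y) = (k *: x) * y.
Proof. exact: algscaleAl. Qed.

Lemma assoc_scalerAr (K : fieldType) (A : assocAlgType K) (k : K) (x y : A) :
  k *: (x * y) = x * (k *: y).
Proof. exact: algscaleAr. Qed.

Definition assocAlg_of_algType (K : fieldType) (A : algType K) :
    assocAlgType K :=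
  HB.pack (GRing.Algebra.sort A)
    (PzRing_isAssocAlgebra.Build K (GRing.Algebra.sort A)
      (@scalerA K A) (@scale1r K A) (@scalerDr K A) (fun v => @scalerDl K A v)
      (@scalerAl K A) (@scalerAr K A)).

Section Notions.
Variables (K : fieldType).

Definition long_commutator (A : pzRingType) (a : A) (s : seq A) : A :=
  foldl (fun u v => u * v - v * u) a s.

(* [a] is a_1 and [s] lists a_2, ..., a_{p+1}. *)
Definition lie_nilpotent (A : pzRingType) : Prop :=
  exists2 p : nat, (0 < p)%N &
    forall (a : A) (s : p.-tuple A), long_commutator a s = 0.

(* The closure conditions are those of [subalg_closed]. *)
Definition finitely_generated (A : assocAlgType K) : Prop :=
  exists s : seq A, forall S : {pred A},
    1 \in S -> linear_closed S -> GRing.mulr_2closed S ->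
    {subset s <= S} -> forall x, x \in S.

Definition bilinear_map (U V W : lmodType K) (f : U -> V -> W) : Prop :=
  (forall v, linear (f^~ v)) /\ (forall u, linear (f u)).

End Notions.

Section TensorSpace.
Variables (K : fieldType) (U V : lmodType K).
Implicit Types (s t : seq (U * V)) (a : K) (u : U) (v : V).

(* A sequence of pairs (u_i, v_i) stands for the sum of the u_i (x) v_i; the  *)
(* tensor product is the quotient of these formal sums by the congruence       *)
(* generated by commutativity and bilinearity.                                 *)
Inductive tensor_eq : seq (U * V) -> seq (U * V) -> Prop :=
| tensor_eq_refl s : tensor_eq s s
| tensor_eq_sym s t : tensor_eq s t -> tensor_eq t s
| tensor_eq_trans s t r : tensor_eq s t -> tensor_eq t r -> tensor_eq s r
| tensor_eq_cat s1 t1 s2 t2 :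
    tensor_eq s1 t1 -> tensor_eq s2 t2 -> tensor_eq (s1 ++ s2) (t1 ++ t2)
| tensor_eq_catC s t : tensor_eq (s ++ t) (t ++ s)
| tensor_eq_addl u u' v : tensor_eq [:: (u + u', v)] [:: (u, v); (u', v)]
| tensor_eq_addr u v v' : tensor_eq [:: (u, v + v')] [:: (u, v); (u, v')]
| tensor_eq_scale a u v : tensor_eq [:: (a *: u, v)] [:: (u, a *: v)]
| tensor_eq_0 v : tensor_eq [:: (0, v)] [::].

Definition tensor_rel : rel (seq (U * V)) := fun s t => `[< tensor_eq s t >].

Lemma tensor_rel_refl : reflexive tensor_rel.
Proof. by move=> s; apply/asboolP; apply: tensor_eq_refl. Qed.

Lemma tensor_rel_sym : symmetric tensor_rel.
Proof. by move=> s t; apply/asboolP/asboolP; apply: tensor_eq_sym. Qed.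

Lemma tensor_rel_trans : transitive tensor_rel.
Proof.
move=> t s r /asboolP st /asboolP tr; apply/asboolP.
exact: tensor_eq_trans st tr.
Qed.

Canonical tensor_equiv :=
  EquivRel tensor_rel tensor_rel_refl tensor_rel_sym tensor_rel_trans.

Definition tensor := {eq_quot tensor_equiv}.

HB.instance Definition _ := Choice.on tensor.
HB.instance Definition _ := EqQuotient.on tensor.

Lemma tensor_piP s t : \pi_tensor s = \pi_tensor t <-> tensor_eq s t.
Proof. by split=> [/eqmodP/asboolP|st]; [|apply/eqmodP/asboolP]. Qed.

Lemma tensor_repr s : tensor_eq (repr (\pi_tensor s)) s.
Proof. by apply/tensor_piP; rewrite reprK. Qed.

Lemma tensor_seqP (P : tensor -> Prop) :
  (forall s, P (\pi_tensor s)) -> forall x, P x.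
Proof. by move=> Ps x; rewrite -(reprK x). Qed.

Definition tensor_zero : tensor := \pi_tensor [::].
Definition tensor_add (x y : tensor) : tensor := \pi_tensor (repr x ++ repr y).
Definition scale_seq a s := [seq (a *: p.1, p.2) | p <- s].
Definition tensor_scale a (x : tensor) : tensor :=
  \pi_tensor (scale_seq a (repr x)).
Definition tensor_opp (x : tensor) : tensor := tensor_scale (-1) x.

Lemma tensor_addE s t :
  tensor_add (\pi_tensor s) (\pi_tensor t) = \pi_tensor (s ++ t).
Proof. by apply/tensor_piP/tensor_eq_cat; apply: tensor_repr. Qed.

Lemma scale_seq_eq a s t :
  tensor_eq s t -> tensor_eq (scale_seq a s) (scale_seq a t).
Proof.
rewrite /scale_seq; elim=> {s t} [s|s t _|s t r _ + _|s1 t1 s2 t2 _ + _|s t|u u' v|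
  u v v'|b u v|v] /=.
- exact: tensor_eq_refl.
- exact: tensor_eq_sym.
- exact: tensor_eq_trans.
- by rewrite !map_cat; apply: tensor_eq_cat.
- by rewrite !map_cat; apply: tensor_eq_catC.
- by rewrite scalerDr; apply: tensor_eq_addl.
- exact: tensor_eq_addr.
- by rewrite scalerA mulrC -scalerA; apply: tensor_eq_scale.
- by rewrite scaler0; apply: tensor_eq_0.
Qed.

Lemma tensor_scaleE a s :
  tensor_scale a (\pi_tensor s) = \pi_tensor (scale_seq a s).
Proof. by apply/tensor_piP/scale_seq_eq/tensor_repr. Qed.

Lemma tensor_addA : associative tensor_add.
Proof.
by elim/tensor_seqP=> r; elim/tensor_seqP=> s; elim/tensor_seqP=> t; rewrite !tensor_addE catA.
Qed.

Lemma tensor_addC : commutative tensor_add.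
Proof.
elim/tensor_seqP=> s; elim/tensor_seqP=> t; rewrite !tensor_addE.
exact/tensor_piP/tensor_eq_catC.
Qed.

Lemma tensor_add0 : left_id tensor_zero tensor_add.
Proof. by elim/tensor_seqP=> s; rewrite tensor_addE. Qed.

Lemma scale_seqDl a b s :
  tensor_eq (scale_seq (a + b) s) (scale_seq a s ++ scale_seq b s).
Proof.
elim: s => [|[u v] s IHs] /=; first exact: tensor_eq_refl.
rewrite scalerDl.
apply: (tensor_eq_trans (tensor_eq_cat (tensor_eq_addl _ _ _) IHs)) => /=.
apply: (@tensor_eq_cat [:: _] [:: _]); first exact: tensor_eq_refl.
rewrite -[(b *: u, v) :: _]/([:: (b *: u, v)] ++ _) -[(b *: u, v) :: scale_seq b s]cat1s !catA.
by apply: tensor_eq_cat; [apply: tensor_eq_catC | apply: tensor_eq_refl].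
Qed.

Lemma scale_seq0 s : tensor_eq (scale_seq 0 s) [::].
Proof.
elim: s => [|[u v] s IHs] /=; first exact: tensor_eq_refl.
by rewrite scale0r; apply: tensor_eq_cat (tensor_eq_0 v) IHs.
Qed.

Lemma scale_seq1 s : scale_seq 1 s = s.
Proof. by rewrite /scale_seq -[RHS]map_id; apply: eq_map => -[u v]; rewrite /= scale1r. Qed.

Lemma tensor_addN : left_inverse tensor_zero tensor_opp tensor_add.
Proof.
elim/tensor_seqP=> s; rewrite /tensor_opp tensor_scaleE tensor_addE.
apply/tensor_piP; rewrite -[X in _ ++ X]scale_seq1.
apply: tensor_eq_trans (tensor_eq_sym (scale_seqDl _ _ _)) _.
by rewrite addNr; apply: scale_seq0.
Qed.

HB.instance Definition _ :=
  GRing.isZmodule.Build tensor tensor_addA tensor_addC tensor_add0 tensor_addN.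

Lemma tensor_scaleA a b x :
  tensor_scale a (tensor_scale b x) = tensor_scale (a * b) x.
Proof.
elim/tensor_seqP: x => s; rewrite !tensor_scaleE; congr (\pi_tensor _).
by rewrite /scale_seq -map_comp; apply: eq_map => p /=; rewrite scalerA.
Qed.

Lemma tensor_scale1 : left_id 1 tensor_scale.
Proof. by elim/tensor_seqP=> s; rewrite tensor_scaleE scale_seq1. Qed.

Lemma tensor_scaleDr : right_distributive tensor_scale +%R.
Proof.
move=> a; elim/tensor_seqP=> s; elim/tensor_seqP=> t.
by rewrite /GRing.add /= !(tensor_addE, tensor_scaleE) /scale_seq map_cat.
Qed.

Lemma tensor_scaleDl x : {morph tensor_scale^~ x : a b / a + b}.
Proof.
move=> a b; elim/tensor_seqP: x => s /=.
rewrite [X in _ = X]/GRing.add /= !(tensor_addE, tensor_scaleE).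
exact/tensor_piP/scale_seqDl.
Qed.

HB.instance Definition _ := GRing.Zmodule_isLmodule.Build K tensor
  tensor_scaleA tensor_scale1 tensor_scaleDr tensor_scaleDl.

Definition pure_tensor u v : tensor := \pi_tensor [:: (u, v)].

Lemma pure_tensor_bilinear : bilinear_map pure_tensor.
Proof.
split=> [v a u u'|u a v v'];
  rewrite /pure_tensor /GRing.scale /GRing.add /= tensor_scaleE tensor_addE.
  exact/tensor_piP/tensor_eq_addl.
apply/tensor_piP; apply: tensor_eq_trans (tensor_eq_addr _ _ _) _.
apply: (@tensor_eq_cat [:: _] [:: _]); last exact: tensor_eq_refl.
exact/tensor_eq_sym/tensor_eq_scale.
Qed.

Lemma tensor_piE s :
  \pi_tensor s = \sum_(p <- s) pure_tensor p.1 p.2.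
Proof.
elim: s => [|[u v] s IHs]; first by rewrite big_nil.
by rewrite big_cons -IHs /GRing.add /= tensor_addE.
Qed.

Lemma tensor_sum (x : tensor) :
  x = \sum_(p <- repr x) pure_tensor p.1 p.2.
Proof. by rewrite -tensor_piE reprK. Qed.

Lemma bilinear_sum_eq (W : lmodType K) (f : U -> V -> W) s t :
  bilinear_map f -> tensor_eq s t ->
  \sum_(p <- s) f p.1 p.2 = \sum_(p <- t) f p.1 p.2.
Proof.
move=> [fl fr].
have f0 v : f 0 v = 0 by rewrite -(subrr 0) addrC -scaleN1r fl scaleN1r addNr.
have f0r u : f u 0 = 0 by rewrite -(subrr 0) addrC -scaleN1r fr scaleN1r addNr.
elim=> {s t} [//|s t _ -> //|s t r _ -> _ -> //|s1 t1 s2 t2 _ e1 _ e2|s t|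
  u u' v|u v v'|a u v|v]; rewrite ?big_cat ?big_cons ?big_nil /= ?addr0.
- by rewrite e1 e2.
- by rewrite addrC.
- by rewrite -[u]scale1r fl !scale1r.
- by rewrite -[v]scale1r fr !scale1r.
- by rewrite -[_ *: u]addr0 -[_ *: v]addr0 fl fr f0 f0r.
- exact: f0.
Qed.

Definition tensor_lift (W : lmodType K) (f : U -> V -> W) (x : tensor) : W :=
  \sum_(p <- repr x) f p.1 p.2.

Lemma tensor_liftE (W : lmodType K) (f : U -> V -> W) s :
  bilinear_map f ->
  tensor_lift f (\pi_tensor s) = \sum_(p <- s) f p.1 p.2.
Proof. by move=> bf; apply: bilinear_sum_eq bf (tensor_repr s). Qed.

Lemma tensor_lift_linear (W : lmodType K) (f : U -> V -> W) :
  bilinear_map f -> linear (tensor_lift f).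
Proof.
move=> bf a; elim/tensor_seqP=> s; elim/tensor_seqP=> t.
rewrite {1}/GRing.scale {1}/GRing.add /= tensor_scaleE tensor_addE.
rewrite !tensor_liftE // big_cat /= big_map scaler_sumr; congr (_ + _).
apply: eq_bigr => p _ /=; case: bf => fl fr.
rewrite -[_ *: p.1]addr0 fl.
by rewrite [f 0 _](_ : _ = 0) ?addr0 // -(subrr 0) addrC -scaleN1r fl scaleN1r addNr.
Qed.

Theorem tensor_universal (W : lmodType K) (f : U -> V -> W) :
  bilinear_map f ->
  exists! g : tensor -> W, linear g /\ forall u v, g (pure_tensor u v) = f u v.
Proof.
move=> bf; exists (tensor_lift f); split.
  split=> [|u v]; first exact: tensor_lift_linear.
  by rewrite tensor_liftE // big_seq1.
move=> g [gl gf]; apply/funext=> x; rewrite [in RHS](tensor_sum x).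
have g0 : g 0 = 0 by rewrite -(subrr 0) addrC -scaleN1r gl scaleN1r addNr.
have gD y z : g (y + z) = g y + g z by rewrite -[y]scale1r gl !scale1r.
by rewrite (big_morph g gD g0); apply: eq_bigr => p _; rewrite gf.
Qed.

End TensorSpace.

Section TensorAlgebra.
Variables (K : fieldType) (G H : assocAlgType K).
Local Notation T := (tensor G H).
Local Notation pure := (@pure_tensor K G H).

Definition tensor_mul_pure (g : G) (h : H) : T -> T :=
  tensor_lift (fun (g' : G) (h' : H) => pure (g * g') (h * h')).

Definition tensor_mul (x y : T) : T :=
  tensor_lift (fun (g : G) (h : H) => tensor_mul_pure g h y) x.

Definition tensor_one : T := pure 1 1.

Lemma pureDl g g' h : pure (g + g') h = pure g h + pure g' h.
Proof.
have [fl _] := pure_tensor_bilinear G H.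
by rewrite -[g]scale1r fl !scale1r.
Qed.

Lemma pureDr g h h' : pure g (h + h') = pure g h + pure g h'.
Proof.
have [_ fr] := pure_tensor_bilinear G H.
by rewrite -[h]scale1r fr !scale1r.
Qed.

Lemma pureZl k g h : pure (k *: g) h = k *: pure g h.
Proof.
have [fl _] := pure_tensor_bilinear G H; apply: (addIr (pure 0 h)).
by rewrite -pureDl fl.
Qed.

Lemma pureZr k g h : pure g (k *: h) = k *: pure g h.
Proof.
have [_ fr] := pure_tensor_bilinear G H; apply: (addIr (pure g 0)).
by rewrite -pureDr fr.
Qed.

Lemma mul_pure_bilinear g h :
  bilinear_map (fun (g' : G) (h' : H) => pure (g * g') (h * h')).
Proof.
split=> [h' k x y|g' k x y]; rewrite mulrDr -assoc_scalerAr.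
  by rewrite pureDl pureZl.
by rewrite pureDr pureZr.
Qed.

Lemma tensor_mul_bilinear y :
  bilinear_map (fun (g : G) (h : H) => tensor_mul_pure g h y).
Proof.
split=> [h k g g'|g k h h']; rewrite /tensor_mul_pure /tensor_lift scaler_sumr
  -big_split; apply: eq_bigr => p _ /=; rewrite mulrDl -assoc_scalerAl.
  by rewrite pureDl pureZl.
by rewrite pureDr pureZr.
Qed.

Lemma tensor_mul_linear_l y : linear (tensor_mul^~ y).
Proof. exact/tensor_lift_linear/tensor_mul_bilinear. Qed.

Lemma tensor_mul_linear_r x : linear (tensor_mul x).
Proof.
move=> k y z; rewrite /tensor_mul /tensor_lift scaler_sumr -big_split.
apply: eq_bigr => p _ /=.
exact: (tensor_lift_linear (mul_pure_bilinear p.1 p.2)).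
Qed.

Lemma tensor_mulDl : left_distributive tensor_mul +%R.
Proof.
by move=> x y z; rewrite -[x]scale1r (tensor_mul_linear_l z) !scale1r.
Qed.

Lemma tensor_mulDr : right_distributive tensor_mul +%R.
Proof.
by move=> x y z; rewrite -[y]scale1r (tensor_mul_linear_r x) !scale1r.
Qed.

Lemma tensor_mul0l x : tensor_mul 0 x = 0.
Proof. by apply: (addIr (tensor_mul 0 x)); rewrite -tensor_mulDl !add0r. Qed.

Lemma tensor_mul0r x : tensor_mul x 0 = 0.
Proof. by apply: (addIr (tensor_mul x 0)); rewrite -tensor_mulDr !add0r. Qed.

Lemma tensor_mul_pureE g h g' h' :
  tensor_mul (pure g h) (pure g' h') = pure (g * g') (h * h').
Proof.
rewrite /tensor_mul tensor_liftE; last exact: tensor_mul_bilinear.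
rewrite big_seq1 /tensor_mul_pure tensor_liftE; last exact: mul_pure_bilinear.
by rewrite big_seq1.
Qed.

Lemma tensor_ind (P : T -> Prop) :
  P 0 -> (forall g h, P (pure g h)) -> (forall x y, P x -> P y -> P (x + y)) ->
  forall x, P x.
Proof.
move=> P0 P1 PD x; rewrite (tensor_sum x).
by apply: big_ind => // p _; apply: P1.
Qed.

Lemma tensor_mulA : associative tensor_mul.
Proof.
move=> x y z.
elim/tensor_ind: x => [|g1 h1|x x' ex ex']; first by rewrite !tensor_mul0l.
  elim/tensor_ind: y => [|g2 h2|y y' ey ey'].
  - by rewrite !(tensor_mul0l, tensor_mul0r).
  - elim/tensor_ind: z => [|g3 h3|z z' ez ez']; first by rewrite !tensor_mul0r.
      by rewrite !tensor_mul_pureE !mulrA.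
    by rewrite !tensor_mulDr ez ez'.
  - by rewrite !(tensor_mulDr, tensor_mulDl) ey ey'.
by rewrite !tensor_mulDl ex ex'.
Qed.

Lemma tensor_mul1l : left_id tensor_one tensor_mul.
Proof.
elim/tensor_ind=> [|g h|x y ex ey]; first exact: tensor_mul0r.
  by rewrite tensor_mul_pureE !mul1r.
by rewrite tensor_mulDr ex ey.
Qed.

Lemma tensor_mul1r : right_id tensor_one tensor_mul.
Proof.
elim/tensor_ind=> [|g h|x y ex ey]; first exact: tensor_mul0l.
  by rewrite tensor_mul_pureE !mulr1.
by rewrite tensor_mulDl ex ey.
Qed.

HB.instance Definition _ := GRing.Zmodule_isPzRing.Build T
  tensor_mulA tensor_mul1l tensor_mul1r tensor_mulDl tensor_mulDr.

Lemma tensor_scalerAl (k : K) (x y : T) : k *: (x * y) = (k *: x) * y.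
Proof.
by rewrite -[k *: x]addr0 [RHS](tensor_mul_linear_l y) tensor_mul0l addr0.
Qed.

Lemma tensor_scalerAr (k : K) (x y : T) : k *: (x * y) = x * (k *: y).
Proof.
by rewrite -[k *: y]addr0 [RHS](tensor_mul_linear_r x) tensor_mul0r addr0.
Qed.

HB.instance Definition _ :=
  PzRing_isAssocAlgebra.Build K T
    (@tensor_scaleA _ _ _) (@tensor_scale1 _ _ _) (@tensor_scaleDr _ _ _)
    (@tensor_scaleDl _ _ _) tensor_scalerAl tensor_scalerAr.

Lemma pure_tensorM (g g' : G) (h h' : H) :
  pure g h * pure g' h' = pure (g * g') (h * h').
Proof. exact: tensor_mul_pureE. Qed.

End TensorAlgebra.

(* Main.v *)
Require Import Defs.
From HB Require Import structures.
From mathcomp Require Import all_boot all_algebra.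
From mathcomp Require Import boolp.

(** Write [Z_k(H)] for the largest ideal of [H] whose elements are killed by
    every word in left multiplications and [k] inner derivations. On pure
    tensors, [[g (x) h, g' (x) h'] = [g, g'] (x) h' h + g g' (x) [h, h']]:
    each bracketing either brackets [g] once more, which can happen at most
    [p - 1] times in a row, or lowers the level of [h] in the series [Z_k(H)].
    So it suffices that [1] lies in some [Z_k(H)].

    To see this, descend along the lower central series. If all commutators
    of length [m + 1] lie in an ideal [Z] and [c] is one of length [m >= 2], then
    [c] is central modulo [Z] and [c [x, y, z]] is in [Z] (Latyshev), so the
    annihilator of [c] modulo [Z] is an ideal containing all [[x, y, z]].
    Modulo such an ideal the commutators of the generators are central and of
    square zero, and there are finitely many of them; hence [1] reaches it after
    a number of steps that depends only on the number of generators. *)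

Set Implicit Arguments.
Unset Strict Implicit.
Unset Printing Implicit Defensive.

Import GRing.Theory.
Local Open Scope ring_scope.

(** * Ideals and the upper series modulo an ideal *)

Section UpperSeries.
Variable R : pzRingType.
Implicit Types (a b c h u v x y z : R) (Z : R -> Prop).

Definition lie x y : R := x * y - y * x.

Lemma lieDl x y z : lie (x + y) z = lie x z + lie y z.
Proof. by rewrite /lie mulrDl mulrDr opprD addrACA. Qed.

Lemma lieDr x y z : lie x (y + z) = lie x y + lie x z.
Proof. by rewrite /lie mulrDl mulrDr opprD addrACA. Qed.

Lemma lieC x y : lie x y = - lie y x.
Proof. by rewrite /lie opprB. Qed.

Lemma lieNl x y : lie (- x) y = - lie x y.
Proof. by rewrite /lie mulNr mulrN opprB opprK addrC. Qed.

Lemma lieNr x y : lie x (- y) = - lie x y.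
Proof. by rewrite lieC lieNl opprK -lieC. Qed.

Lemma lie0l x : lie 0 x = 0.
Proof. by rewrite /lie mul0r mulr0 subrr. Qed.

Lemma lie0r x : lie x 0 = 0.
Proof. by rewrite lieC lie0l oppr0. Qed.

Lemma lieMl a b c : lie (a * b) c = a * lie b c + lie a c * b.
Proof. by rewrite /lie mulrBr mulrBl !mulrA addrA subrK. Qed.

Lemma lieMr a b c : lie a (b * c) = b * lie a c + lie a b * c.
Proof. by rewrite lieC lieMl opprD -mulrN -mulNr -!lieC. Qed.

Lemma lie_Jacobi u b c : lie u (lie b c) = lie (lie u b) c - lie (lie u c) b.
Proof.
rewrite {1}[lie b c]/lie lieDr lieNr !lieMr.
rewrite [lie (lie u b) c]/lie [lie (lie u c) b]/lie opprB opprD.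
by rewrite [X in X + _]addrC addrACA.
Qed.

Record ideal Z : Prop := Ideal {
  ideal0 : Z 0;
  idealD : forall x y, Z x -> Z y -> Z (x + y);
  idealMl : forall a x, Z x -> Z (a * x);
  idealMr : forall a x, Z x -> Z (x * a) }.

Lemma idealN Z x : ideal Z -> Z x -> Z (- x).
Proof. by move=> iZ Zx; rewrite -mulN1r; apply: idealMl. Qed.

Lemma idealB Z x y : ideal Z -> Z x -> Z y -> Z (x - y).
Proof. by move=> iZ Zx Zy; apply: idealD => //; apply: idealN. Qed.

Lemma ideal_lie Z x y : ideal Z -> Z x -> Z (lie x y).
Proof. by move=> iZ Zx; apply: idealB => //; [apply: idealMr | apply: idealMl]. Qed.

Lemma ideal_eq0 : ideal (fun x => x = 0).
Proof.
by split=> [|x y -> ->|a x ->|a x ->]; rewrite ?addr0 ?mulr0 ?mul0r.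
Qed.

(** For an ideal [Z], the preimage of Z_k of the quotient by [Z]. The factor [a] makes each new
    level closed under left multiplication. *)
Fixpoint upper_series Z k v : Prop :=
  if k is k'.+1 then forall a h, upper_series Z k' (lie (a * v) h) else Z v.

Lemma upper_seriesD Z k m v :
  upper_series (upper_series Z k) m v <-> upper_series Z (m + k) v.
Proof.
by elim: m v => [|m IH] v //=; split=> Zv a h; apply/IH.
Qed.

Lemma upper_series_ideal Z k : ideal Z -> ideal (upper_series Z k).
Proof.
move=> iZ; elim: k => [|k IH] //; have [I0 ID IMl IMr] := IH.
have Ml a x : upper_series Z k.+1 x -> upper_series Z k.+1 (a * x).
  by move=> Zx b h; rewrite mulrA; apply: Zx.
split=> [a h|x y Zx Zy a h||b x Zx a h] //.
- by rewrite mulr0 lie0l.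
- by rewrite mulrDr lieDl; apply: (ID); [apply: Zx | apply: Zy].
rewrite mulrA lieMl; apply: (ID); last exact/IMr/Zx.
move: (a * x) (Ml a x Zx) => w Zw.
have Zlie u : upper_series Z k (lie w u).
  by have := Zw 1 u; rewrite mul1r.
(* Right closure is not built in: the left-over term is expressed through brackets whose first entry
   is [w] or [b * w]. *)
have -> : w * lie b h = lie (b * w) h - b * lie w h + lie w (lie b h).
  by rewrite lieMl [b * _ + _]addrC addrK [lie w _]/lie addrC subrK.
by apply: (ID) => //; apply: idealB => //; apply: IMl.
Qed.

Lemma sub_upper_series Z k v : ideal Z -> Z v -> upper_series Z k v.
Proof.
move=> iZ; elim: k v => [|k IH] v //= Zv a h.
by apply: IH; apply: ideal_lie => //; apply: idealMl.
Qed.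

Section CentralModulo.
Variables (Z : R -> Prop) (c : R).
Hypotheses (iZ : ideal Z) (cC : forall h, Z (lie c h)).

Lemma annihilator_ideal : ideal (fun a => Z (c * a)).
Proof.
have [I0 ID IMl IMr] := iZ; split=> [|x y Zx Zy|a x Zx|a x Zx].
- by rewrite mulr0.
- by rewrite mulrDr; apply: (ID).
- have -> : c * (a * x) = lie c a * x + a * (c * x).
    by rewrite /lie mulrBl !mulrA subrK.
  by apply: (ID); [apply: IMr | apply: IMl].
- by rewrite mulrA; apply: IMr.
Qed.

(** Multiplication by [c] commutes with left multiplications and brackets up to errors in [Z], and
    these lie in every level. *)
Lemma upper_series_annihilator k v :
  upper_series (fun a => Z (c * a)) k v -> upper_series Z k (c * v).
Proof.
elim: k v => [|k IH] v //= Zv a h.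
have [_ ID _ IMr] := upper_series_ideal k iZ.
have -> : lie (a * (c * v)) h = c * lie (a * v) h + lie c h * (a * v)
                                - lie (lie c a * v) h.
  have -> : a * (c * v) = c * (a * v) - lie c a * v.
    by rewrite /lie mulrBl !mulrA opprB addrC subrK.
  by rewrite lieDl lieMl lieNl.
apply: (idealB (upper_series_ideal k iZ)).
  apply: ID; last by apply/IMr/sub_upper_series.
  by apply: IH => //; apply: Zv.
by apply: sub_upper_series => //; apply: ideal_lie => //; apply: idealMr.
Qed.

End CentralModulo.

(** As [x, xy] = x [x, y], bracketing it with y yields the square of [x, y] plus a multiple of a
    triple commutator. *)
Lemma ideal_sqr_lie Z x y :
  ideal Z -> (forall a b c, Z (lie (lie a b) c)) -> Z (lie x y * lie x y).
Proof.
move=> iZ Z3.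
have -> : lie x y * lie x y = lie (lie x (x * y)) y - x * lie (lie x y) y.
  have lxx : lie x x = 0 by rewrite /lie subrr.
  by rewrite [lie x (x * y)]lieMr lxx mul0r addr0 lieMl addrAC subrr add0r.
by apply: idealB => //; apply: idealMl.
Qed.

(** Modulo [Z], [[u, a] [b, y]] is alternating in [a], [b], [y], so the inner
    bracket [[b1, b2]] can be moved next to [u]. *)
Lemma ideal_lie_mul_lie3 Z u a b1 b2 y :
  ideal Z -> (forall a b, Z (lie (lie u a) b)) ->
  Z (lie u a * lie (lie b1 b2) y).
Proof.
move=> iZ Zu.
(* Leibniz expansion of [[u, de], t]; all other terms contain some [[u, -], -]. *)
have swap d e t : Z (lie u d * lie e t + lie u e * lie d t).
  have -> : lie u d * lie e t + lie u e * lie d t =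
      lie (lie u (d * e)) t - d * lie (lie u e) t - lie (lie u d) t * e
      + lie (lie u e) (lie d t).
    rewrite [lie u (d * e)]lieMr lieDl !lieMl [lie (lie u e) (lie d t)]/lie.
    have cancel (A B C D E : R) : A + B + (C + D) - A - D + (E - B) = C + E.
      rewrite (addrACA A B C D) [A + C]addrC -!addrA (addrCA D (- A)) (addrCA B (- A)).
      by rewrite !addNKr (addrCA B E) subrr addr0.
    by rewrite cancel.
  apply: idealD => //; apply: idealB => //; last exact: idealMr.
  by apply: idealB => //; apply: idealMl.
have -> : lie u a * lie (lie b1 b2) y =
    (lie u a * lie (lie b1 b2) y + lie u (lie b1 b2) * lie a y)
    - lie u (lie b1 b2) * lie a y by rewrite addrK.
apply: idealB => //; apply: idealMr => //.
by rewrite lie_Jacobi; apply: idealB.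
Qed.

End UpperSeries.

(** * Descent along the lower central series *)

Section FinitelyGenerated.
Variables (K : fieldType) (H : assocAlgType K).
Implicit Types (Z : H -> Prop) (a b : H).

Definition generates (s : seq H) : Prop :=
  forall S : {pred H}, 1 \in S -> linear_closed S -> GRing.mulr_2closed S ->
    {subset s <= S} -> forall x, x \in S.

Lemma lieZl k a b : lie (k *: a) b = k *: lie a b :> H.
Proof. by rewrite /lie -assoc_scalerAl -assoc_scalerAr scalerBr. Qed.

(** The centralizer modulo [Z] of any set is a subalgebra; this extends one argument at a time from
    [s] to [H]. *)
Lemma lie_in_ideal (s : seq H) Z :
    generates s -> ideal Z -> (forall x y, x \in s -> y \in s -> Z (lie x y)) ->
  forall a b, Z (lie a b).
Proof.
move=> gen iZ Zs.
have centralizer (t : H -> Prop) :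
    (forall x, x \in s -> forall b, t b -> Z (lie x b)) ->
    forall a b, t b -> Z (lie a b).
  move=> st a; pose S : {pred H} := [pred a | `[< forall b, t b -> Z (lie a b) >]].
  suff: a \in S by move=> /asboolP.
  apply: gen => [|k x y /asboolP Sx /asboolP Sy|x y /asboolP Sx /asboolP Sy|x xs];
    apply/asboolP => b tb.
  - by rewrite /lie mul1r mulr1 subrr; apply: ideal0.
  - rewrite lieDl lieZl -[lie x b]mul1r assoc_scalerAl.
    by apply: (idealD iZ); [apply/(idealMl iZ)/Sx | apply: Sy].
  - by rewrite lieMl; apply: (idealD iZ);
       [apply/(idealMl iZ)/Sy | apply/(idealMr iZ)/Sx].
  - exact: st.
move=> a b; apply: (centralizer xpredT) => // x xs {}b _.
rewrite lieC; apply: idealN => //; apply: (centralizer (fun y => y \in s)) => //.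
by move=> y ys z; apply: Zs.
Qed.

(** Each pair in [l], being central of square zero modulo [Z], doubles the
    number of steps: first to reach [[x, y]] through its annihilator, then to
    reach [1] modulo an ideal that contains [[x, y]]. *)
Lemma upper_series_class2 (s : seq H) (l : seq (H * H)) Z :
    generates s -> ideal Z -> (forall a b c, Z (lie (lie a b) c)) ->
    (forall x y, x \in s -> y \in s -> (x, y) \notin l -> Z (lie x y)) ->
  upper_series Z (2 ^ size l) 1.
Proof.
move=> gen; elim: l Z => [|[x y] l IH] Z iZ Z3 Zs.
  by move=> a h; rewrite mulr1; apply: (lie_in_ideal gen) => // u v us vs; apply: Zs.
rewrite /= expnS mul2n -addnn; apply/upper_seriesD.
have Zxy h : Z (lie (lie x y) h) by apply: Z3.
have Zxyk : upper_series Z (2 ^ size l) (lie x y).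
  rewrite -[lie x y]mulr1; apply: upper_series_annihilator => //.
  have iA := annihilator_ideal iZ Zxy.
  apply: IH => // [a b c|u v us vs uvl]; first exact: idealMl.
  (* The annihilator of [x, y] contains [x, y] itself, so this pair leaves the list. *)
  have [[-> ->]|/eqP uv] := (u, v) =P (x, y); first exact: ideal_sqr_lie.
  by apply: idealMl => //; apply: Zs; rewrite // inE negb_or uv.
apply: IH => [|a b c|u v us vs uvl]; first exact: upper_series_ideal.
  exact: sub_upper_series.
have [[-> ->] //|/eqP uv] := (u, v) =P (x, y).
by apply: sub_upper_series => //; apply: Zs; rewrite // inE negb_or uv.
Qed.

Lemma upper_series_lie_nilpotent :
    finitely_generated H -> lie_nilpotent H ->
  exists k, upper_series (fun v : H => v = 0) k 1.
Proof.
move=> [s gen] [p _ nilH].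
set Z0 := fun v : H => v = 0.
have iZ0 : ideal Z0 := ideal_eq0 H.
suff lower m : (m <= p)%N -> exists k, forall (a : H) (t : seq H),
    size t = (p - m)%N -> upper_series Z0 k (long_commutator a t).
  by have [k Zk] := lower p (leqnn p); exists k; apply: (Zk 1 [::]); rewrite subnn.
elim: m => [_|m IH lt_mp].
  by exists 0%N => a t; rewrite subn0 => /eqP sz; apply: (nilH a (Tuple sz)).
have [k Zk] := IH (ltnW lt_mp).
have iZ := upper_series_ideal k iZ0.
pose l := [seq (x, y) | x <- s, y <- s].
(* The [1] serves commutators of length one, which are arbitrary elements; [2 ^ size l] serves the
   longer ones. *)
exists (1 + (2 ^ size l + k))%N => a t st.
have {st} st : (size t).+1 = (p - m)%N by rewrite st subnS prednK ?subn_gt0.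
case/lastP: t st => [|t b]; rewrite ?size_rcons => st.
  move=> d h; rewrite add0n; apply/upper_seriesD/sub_upper_series => //.
  exact: (Zk (d * a) [:: h]).
pose u := long_commutator a t.
have Zu x y : upper_series Z0 k (lie (lie u x) y).
  have := Zk a (rcons (rcons t x) y); rewrite !size_rcons => /(_ st).
  by rewrite /long_commutator -!cats1 !foldl_cat.
have -> : long_commutator a (rcons t b) = lie u b.
  by rewrite /long_commutator -cats1 foldl_cat.
apply/upper_seriesD/sub_upper_series; first exact: upper_series_ideal.
apply/upper_seriesD; rewrite -[lie u b]mulr1.
apply: upper_series_annihilator => //.
apply: (upper_series_class2 gen) => [|x y z|x y xs ys].
- exact: annihilator_ideal.
- exact: ideal_lie_mul_lie3.
- by case/negP; apply/allpairsP; exists (x, y).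
Qed.

End FinitelyGenerated.

(** * Counting brackets in the tensor product *)

Section Tensor.
Variables (K : fieldType) (G H : assocAlgType K).
Local Notation T := (tensor G H).
Local Notation pure := (@pure_tensor K G H).

Lemma long_commutatorD (A : pzRingType) (x y : A) s :
  long_commutator (x + y) s = long_commutator x s + long_commutator y s.
Proof. by elim: s x y => [|z s IH] x y //=; rewrite -IH -lieDl. Qed.

Lemma long_commutator0 (A : pzRingType) (s : seq A) : long_commutator 0 s = 0.
Proof. by elim: s => [|z s IH] //=; rewrite mul0r mulr0 subrr. Qed.

Lemma pure0l h : pure 0 h = 0 :> T.
Proof. by apply: (addIr (pure 0 h)); rewrite -pureDl !add0r. Qed.

Lemma pure0r g : pure g 0 = 0 :> T.
Proof. by apply: (addIr (pure g 0)); rewrite -pureDr !add0r. Qed.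

Lemma lie_pure g h g' h' :
  lie (pure g h) (pure g' h') =
  pure (lie g g') (h' * h) + pure (g * g') (lie h h') :> T.
Proof.
have pureNl u v : pure (- u) v = - pure u v by rewrite -scaleN1r pureZl scaleN1r.
have pureNr u v : pure u (- v) = - pure u v by rewrite -scaleN1r pureZr scaleN1r.
rewrite /lie pureDl pureDr pureNl pureNr !pure_tensorM.
by rewrite [RHS]addrC [RHS]addrA subrK.
Qed.

(** The budget [k * p + j] drops at each bracketing: a bracket on [g] lowers [j], while one on [h]
    lowers [k] and resets [j] to [p], the new left factor being arbitrary. *)
Lemma long_commutator_pure p :
    (forall (a : G) (s : seq G), size s = p -> long_commutator a s = 0) ->
  forall n j k g h (s : seq T),
    (forall t : seq G, size t = j -> long_commutator g t = 0) ->
    upper_series (fun v : H => v = 0) k h ->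
    (k * p + j <= n)%N -> size s = n -> long_commutator (pure g h) s = 0.
Proof.
move=> nilG; elim=> [|n IH] [|j] k g h s Gj Hk le_n sz.
all: try by have /= -> := Gj [::] erefl; rewrite pure0l long_commutator0.
  by rewrite addnS in le_n.
case: k Hk le_n => [/= ->|k Hk] le_n; first by rewrite pure0r long_commutator0.
case: s sz => [//|x s] [sz]; rewrite /= -/(lie (pure g h) x).
elim/tensor_ind: x => [|g' h'|x y ex ey].
- by rewrite lie0r; apply: long_commutator0.
- rewrite lie_pure [LHS]long_commutatorD.
  rewrite (IH j k.+1) ?(IH p k) ?addr0 //.
  + by move=> t; apply: nilG.
  + by have := Hk 1 h'; rewrite mul1r.
  + by rewrite mulSn addnS ltnS in le_n; apply: leq_trans le_n; rewrite addnC leq_addr.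
  + by move=> t st; apply: (Gj (g' :: t)); rewrite /= st.
  + by apply: (idealMl (upper_series_ideal k.+1 (ideal_eq0 H))).
  + by rewrite addnS ltnS in le_n.
- by rewrite lieDr [LHS]long_commutatorD -/(long_commutator _ s) ex ey addr0.
Qed.

End Tensor.

Theorem corollary2p6 (K : fieldType) (G H : assocAlgType K) :
  lie_nilpotent G -> finitely_generated H -> lie_nilpotent H ->
  lie_nilpotent (tensor G H).
Proof.
move=> [p p_gt0 nilG] fgH nilH.
have [k Hk] := upper_series_lie_nilpotent fgH nilH.
exists (k * p + p)%N => [|x s]; first by rewrite addn_gt0 p_gt0 orbT.
elim/tensor_ind: x => [|g h|x y ex ey]; first exact: long_commutator0.
  apply: (@long_commutator_pure _ _ _ p _ (k * p + p) p k) => //.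
  - by move=> a t /eqP st; apply: (nilG a (Tuple st)).
  - by move=> t /eqP st; apply: (nilG g (Tuple st)).
  - by rewrite -[h]mulr1; apply: (idealMl (upper_series_ideal k (ideal_eq0 H))).
  - by rewrite size_tuple.
by rewrite long_commutatorD ex ey addr0.
Qed.
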